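(* Let $a,b,s,h$ be positive integers with $s\ge 2$ and $r=a+b\ge 3$, and suppose that if $(a,b)=(1,r-1)$ then $h=1$. Then there exists a constant $C=C(r,s,h)>0$ such that every $n$-vertex $r$-uniform hypergraph $\mathcal H$ satisfying \[ |\mathcal H| > (s-1)\,|\partial \mathcal H| + C n^{r-2} \] contains the bush $\mathcal B_{s,h}(a,b)$.
   Context: An $r$-uniform hypergraph ($r$-graph) is identified with its edge set, a family of $r$-element subsets of its vertex set. The shadow $\partial\mathcal H$ of an $r$-graph $\mathcal H$ is the family of $(r-1)$-element sets contained in some edge of $\mathcal H$. For positive integers $a,b,s,h$ with $s\ge2$ and $r=a+b$, the bush $\mathcal B_{s,h}(a,b)$ is the $r$-graph constructed as follows: take pairwise disjoint sets $A$ with $|A|=a$, $B_1,\dots,B_s$ with $|B_i|=b$, and $A_{i,j}$ ($i\in[s]$, $j\in[h]$) with $|A_{i,j}|=a$; its edges are $A\cup B_i$ for $i\in[s]$ and $B_i\cup A_{i,j}$ for $i\in[s]$, $j\in[h]$. (It is the $(a,b)$-blowup of the graph tree obtained from the star $K_{1,s}$ by attaching $h$ new leaves to each leaf.) ''$\mathcal H$ contains $\mathcal B_{s,h}(a,b)$'' means $\mathcal H$ has a subfamily isomorphic to it. *)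

(* Defs.v *)
From mathcomp Require Import all_boot all_order all_algebra.
From mathcomp Require Import reals.

Set Implicit Arguments.
Unset Strict Implicit.
Unset Printing Implicit Defensive.

(* A hypergraph on T is its edge set, of type {set {set T}}. *)

Definition uniform (r : nat) (T : finType) (H : {set {set T}}) : bool :=
  [forall e in H, #|e| == r].

Definition shadow (r : nat) (T : finType) (H : {set {set T}}) : {set {set T}} :=
  [set S : {set T} | (#|S| == r.-1) && [exists e in H, S \subset e]].

(* As a hypergraph is identified with its edge set, its vertices are those
   covered by its edges; f is unconstrained elsewhere. *)
Definition isomorphic (V T : finType)
    (F : {set {set V}}) (G : {set {set T}}) : Prop :=
  exists f : V -> T,
    {in cover F &, injective f} /\ [set f @: (e : {set V}) | e in F] = G.

Definition contains (V T : finType)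
    (H : {set {set T}}) (F : {set {set V}}) : Prop :=
  exists2 G : {set {set T}}, G \subset H & isomorphic F G.

Section Bush.
Variables (a b s h : nat).

(* The disjoint union of A, the B_i and the A_{i,j}, in this order. *)
Definition bush_vertex : finType :=
  ('I_a + 'I_s * 'I_b + 'I_s * 'I_h * 'I_a)%type.

Definition bush_root : {set bush_vertex} :=
  [set (inl (inl x) : bush_vertex) | x : 'I_a].

Definition bush_mid (i : 'I_s) : {set bush_vertex} :=
  [set (inl (inr (i, y)) : bush_vertex) | y : 'I_b].

Definition bush_leaf (i : 'I_s) (j : 'I_h) : {set bush_vertex} :=
  [set (inr (i, j, x) : bush_vertex) | x : 'I_a].

Definition bush : {set {set bush_vertex}} :=
  [set bush_root :|: bush_mid i | i : 'I_s] :|: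
  [set bush_mid i :|: bush_leaf i j | i : 'I_s, j : 'I_h].

End Bush.

(* Main.v *)
Require Import Defs.
From mathcomp Require Import all_boot all_order all_algebra.
From mathcomp Require Import boolp reals zify.

(** Suppose that H has no bush. Call a family of sets rich when it has members
    avoiding any prescribed set of bounded size; when it is not, a bounded set
    meets all its members. Hence, if the sets [e :\: Q] for the edges e of some
    kind through Q do not form a rich family, Q forces one of boundedly many
    vertices into each of these edges. A subset of an edge e is stable when it
    forces no further vertex of e. An edge in which some [(r - 2)]-subset P
    lies in no proper stable subset is determined by P up to O(1) choices, so
    there are only O(n^(r-2)) such edges, which may be discarded.

    Let N be the set of the x in e such that [e :\ x] is unstable. In a remaining
    edge e, [e :\: S] is stable as soon as [#|S :&: N| != 1]. On the other hand a
    stable set has rich links, from which a bush can be built greedily, so no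
    stable a-set has a stable complement in e. This leaves only [#|N| = 1], or
    [b = 1], or [a = b = 2] with [#|N| = 3], or [a = 1] with [N = e]; in each
    case a weighted count of the remaining edges over the shadow bounds their
    number by (s-1) times the size of the shadow. *)

Set Implicit Arguments.
Unset Strict Implicit.
Unset Printing Implicit Defensive.

(** * Enumerating finite sets and embedding the bush *)

Section SetEnumeration.
Variables (T : finType) (x0 : T).

Lemma imset_nth_enum (X : {set T}) n : #|X| = n ->
  [set nth x0 (enum X) i | i : 'I_n] = X.
Proof.
move=> cX; apply/setP=> x; apply/imsetP/idP => [[i _ ->]|xX].
  by rewrite -mem_enum mem_nth // -cardE cX.
have lt_i : index x (enum X) < n by rewrite -cX cardE index_mem mem_enum.
by exists (Ordinal lt_i) => //=; rewrite nth_index // mem_enum.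
Qed.

Lemma nth_enum_in (X : {set T}) n (i : 'I_n) : #|X| = n ->
  nth x0 (enum X) i \in X.
Proof. by move=> cX; rewrite -mem_enum mem_nth // -cardE cX. Qed.

Lemma nth_enum_inj (X : {set T}) n : #|X| = n ->
  injective (fun i : 'I_n => nth x0 (enum X) i).
Proof.
move=> cX i j /eqP; rewrite nth_uniq -?cardE ?cX ?enum_uniq //.
by move/eqP/val_inj.
Qed.

End SetEnumeration.

Lemma disjoint_neq (T : finType) (X Y : {set T}) x y :
  [disjoint X & Y] -> x \in X -> y \in Y -> x <> y.
Proof. by move=> dXY xX yY exy; rewrite exy (disjointFl dXY) in xX. Qed.

Lemma leq_card_bigcup (I T : finType) (P : {pred I}) (F : I -> {set T}) t :
  (forall i, i \in P -> #|F i| <= t) -> #|\bigcup_(i in P) F i| <= #|P| * t.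
Proof.
move=> Ft; rewrite -sum_nat_const.
apply: (big_ind2 (fun (X : {set T}) m => #|X| <= m)); first by rewrite cards0.
  move=> X m Y p Xm Yp; apply: leq_trans (leq_card_setU _ _) _.
  exact: leq_add.
exact: Ft.
Qed.

(** Each block of the bush is mapped onto its target set along enumerations; disjointness of the
    targets makes this map injective. *)
Lemma contains_bush (a b s h : nat) (T : finType) (H : {set {set T}})
    (A : {set T}) (B : 'I_s -> {set T}) (C : 'I_s * 'I_h -> {set T}) :
  0 < a -> #|A| = a -> (forall i, #|B i| = b) -> (forall p, #|C p| = a) ->
  (forall i, [disjoint A & B i]) -> (forall p, [disjoint A & C p]) ->
  (forall i j, i != j -> [disjoint B i & B j]) ->
  (forall i p, [disjoint B i & C p]) ->
  (forall p q, p != q -> [disjoint C p & C q]) ->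
  (forall i, A :|: B i \in H) -> (forall p, B p.1 :|: C p \in H) ->
  contains H (bush a b s h).
Proof.
move=> a0 cA cB cC dAB dAC dBB dBC dCC AB BC.
(* Any element of [A] can serve as the default value of [nth]. *)
have /card_gt0P[x0 _] : 0 < #|A| by rewrite cA.
pose f (v : bush_vertex a b s h) : T := match v with
  | inl (inl x) => nth x0 (enum A) x
  | inl (inr (i, y)) => nth x0 (enum (B i)) y
  | inr (p, x) => nth x0 (enum (C p)) x end.
have fA x : f (inl (inl x)) \in A by apply: nth_enum_in.
have fB i y : f (inl (inr (i, y))) \in B i by apply: nth_enum_in.
have fC p x : f (inr (p, x)) \in C p by apply: nth_enum_in.
have f_inj : injective f.
  move=> [[x|[i y]]|[p x]] [[x'|[i' y']]|[p' x']] E.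
  - by move: E => /(nth_enum_inj cA) ->.
  - by have := disjoint_neq (dAB i') (fA x) (fB i' y').
  - by have := disjoint_neq (dAC p') (fA x) (fC p' x').
  - by have := disjoint_neq (dAB i) (fA x') (fB i y); rewrite E.
  - have [ii'|/dBB dii'] := eqVneq i i'.
      by move: E; rewrite -ii' => /(nth_enum_inj (cB i)) ->.
    by have := disjoint_neq dii' (fB i y) (fB i' y').
  - by have := disjoint_neq (dBC i p') (fB i y) (fC p' x').
  - by have := disjoint_neq (dAC p) (fA x') (fC p x); rewrite E.
  - by have := disjoint_neq (dBC i' p) (fB i' y') (fC p x); rewrite E.
  - have [pp'|/dCC dpp'] := eqVneq p p'.
      by move: E; rewrite -pp' => /(nth_enum_inj (cC p)) ->.
    by have := disjoint_neq dpp' (fC p x) (fC p' x').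
have fr : f @: bush_root a b s h = A.
  by rewrite -imset_comp; apply: (imset_nth_enum x0 cA).
have fm i : f @: bush_mid a b h i = B i.
  by rewrite -imset_comp; apply: (imset_nth_enum x0 (cB i)).
have fl i j : f @: bush_leaf a b i j = C (i, j).
  by rewrite -imset_comp; apply: (imset_nth_enum x0 (cC (i, j))).
exists [set f @: (e : {set _}) | e in bush a b s h]; last first.
  by exists f; split => // x y _ _; apply: f_inj.
apply/subsetP => _ /imsetP[e he ->].
case/setUP: he => [/imsetP[i _ ->]|/imset2P[i j _ _ ->]].
  by rewrite imsetU fr fm.
by rewrite imsetU fm fl; exact: (BC (i, j)).
Qed.

(** * Rich families and bounded transversals *)

Section Rich.
Variable T : finType.
Implicit Types (F H : {set {set T}}) (Z Q e : {set T}).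

Definition rich k F :=
  [forall Z : {set T}, (#|Z| <= k) ==> [exists f in F, [disjoint f & Z]]].

(** A transversal of bounded size, if there is one. The default [set0] keeps the size bound in every
    case and lets a rich family force nothing. *)
Definition cov k F : {set T} :=
  if [pick Z : {set T} | (#|Z| <= k) && [forall f in F, ~~ [disjoint f & Z]]]
    is Some Z then Z else set0.

Lemma richP k F : reflect
  (forall Z, #|Z| <= k -> exists2 f, f \in F & [disjoint f & Z]) (rich k F).
Proof.
apply: (iffP forallP) => [rF Z cZ | rF Z].
  by have /implyP/(_ cZ)/existsP[f /andP[]] := rF Z; exists f.
apply/implyP=> /rF[f fF dfZ]; apply/existsP; exists f; exact/andP.
Qed.

Lemma card_cov k F : #|cov k F| <= k.
Proof. by rewrite /cov; case: pickP => [Z /andP[] //|_]; rewrite cards0. Qed.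

Lemma covP k F f : ~~ rich k F -> f \in F -> ~~ [disjoint f & cov k F].
Proof.
rewrite /cov => nrF fF; case: pickP => [Z /andP[_ /forall_inP]|noZ]; first exact.
case/negP: nrF; apply/richP => Z cZ.
have := noZ Z; rewrite cZ => /forall_inPn[g gF]; rewrite negbK => dgZ.
by exists g.
Qed.

Lemma rich_witness k F f : f \in F -> [disjoint f & cov k F] -> rich k F.
Proof. by move=> fF dfF; apply: contraT => /covP/(_ fF); rewrite dfF. Qed.

(** Greedy choice: [Z0] and the sets already chosen have together at most [k] elements, so the next
    rich family still has a member avoiding them. *)
Lemma disjoint_choice (I : finType) k t Z0 (G : I -> {set {set T}}) :
  (forall i f, f \in G i -> #|f| <= t) -> (forall i, rich k (G i)) ->
  #|Z0| + #|I|.-1 * t <= k ->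
  exists g : I -> {set T},
    [/\ forall i, g i \in G i, forall i, [disjoint g i & Z0] &
        forall i j, i != j -> [disjoint g i & g j]].
Proof.
move=> Gt Gr lek.
suff [g [gG gZ gg]] : exists g : I -> {set T},
    [/\ {in enum I, forall i, g i \in G i},
        {in enum I, forall i, [disjoint g i & Z0]} &
        {in enum I &, forall i j, i != j -> [disjoint g i & g j]}].
  by exists g; split=> [i|i|i j]; [apply: gG|apply: gZ|apply: gg];
     rewrite mem_enum.
elim: (enum I) (enum_uniq I) => [_|i l IHl /= /andP[il ul]].
  by exists (fun=> set0); split.
have [g [gG gZ gg]] := IHl ul.
have lt_l : size l < #|I|.
  by have := max_card (mem (i :: l)); rewrite (card_uniqP _) //= il.
pose Z := Z0 :|: \bigcup_(j in l) g j.
have cZ : #|Z| <= k.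
  apply: leq_trans lek; apply: leq_trans (leq_card_setU _ _) _.
  rewrite leq_add2l; apply: (@leq_trans (#|l| * t)).
    by apply: leq_card_bigcup => j jl; apply: (Gt j); apply: gG.
  by rewrite leq_mul2r -ltnS (ltn_predK lt_l) (leq_ltn_trans _ lt_l) ?orbT
     ?card_size.
have [f fG fZ] := richP _ _ (Gr i) _ cZ.
have fZ0 : [disjoint f & Z0] by apply: disjointWr fZ; apply: subsetUl.
have fgl j : j \in l -> [disjoint f & g j].
  move=> jl; apply: disjointWr fZ; apply: subset_trans (subsetUr _ _).
  exact: bigcup_sup.
have ne j : j \in l -> (j == i) = false.
  by move=> jl; apply: contraNF il => /eqP <-.
exists (fun j => if j == i then f else g j); split.
- move=> j; rewrite in_cons; case: eqVneq => [-> //|_ /= jl]; exact: gG.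
- move=> j; rewrite in_cons; case: eqVneq => [_ _|_ /= jl]; [exact: fZ0|exact: gZ].
move=> j j'; rewrite !in_cons.
case: (eqVneq j i) => [->|nj] /=; case: (eqVneq j' i) => [->|nj'] //=.
- by move=> _ /fgl.
- by move=> /fgl; rewrite disjoint_sym.
exact: gg.
Qed.

Definition link H Q := [set e :\: Q | e in H & Q \subset e].

Lemma linkP H Q f : reflect
  (exists e, [/\ e \in H, Q \subset e & f = e :\: Q]) (f \in link H Q).
Proof.
apply: (iffP imsetP) => [[e]|[e [eH Qe ->]]].
  by rewrite inE => /andP[eH Qe] ->; exists e.
by exists e => //; rewrite inE eH.
Qed.

End Rich.

Lemma leq_bin_expn n m : 'C(n, m) <= n ^ m.
Proof.
have le_ffact : n ^_ m <= n ^ m.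
  elim: m n => [|m IHm] n //; rewrite ffactnS expnS leq_mul2l.
  rewrite (leq_trans (IHm _)) ?orbT //.
  by case: m {IHm} => // m; rewrite leq_exp2r ?leq_pred.
by apply: leq_trans le_ffact; rewrite -bin_ffact leq_pmulr // fact_gt0.
Qed.

(** * Stability under a monotone forcing map *)

Section Stable.
Variables (T : finType) (W : {set T} -> {set T}).
Hypothesis W_mono : forall P Q : {set T}, P \subset Q -> W P \subset W Q.
Implicit Types (e P Q S : {set T}).

Definition stable e S := W S :&: e \subset S.

Definition good r e := [forall P : {set T}, (P \subset e) && (#|P| == r - 2) ==>
  [exists S : {set T}, [&& P \subset S, S \proper e & stable e S]]].

Definition unstable e := [set x in e | ~~ stable e (e :\ x)].

Lemma stableT e : stable e e.
Proof. exact: subsetIr. Qed.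

Lemma stableP e S x : stable e S -> x \in W S -> x \in e -> x \in S.
Proof. by move=> /subsetP clS xW xe; apply: clS; rewrite inE xW. Qed.

Lemma unstable_sub e : unstable e \subset e.
Proof. by apply/subsetP=> x; rewrite inE => /andP[]. Qed.

(** If [z] in [S] is forced by [e :\: S], every stable superset of [e :\: S] contains [z]; so [z] is
    unstable and [S] has a second unstable vertex [y]. Goodness puts [e :\ y :\ z] in a proper
    stable subset, which contains [z] and thus equals [e :\ y], against the instability of [y]. *)
Lemma good_stable r e S : #|e| = r -> good r e -> S \subset e ->
  #|S :&: unstable e| != 1 -> stable e (e :\: S).
Proof.
move=> ce ge Se cSN; apply/subsetP => z; rewrite !inE => /andP[zW ze].
rewrite ze andbT; apply/negP => zS.
have Wz Q : e :\: S \subset Q -> stable e Q -> z \in Q.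
  by move=> /W_mono/subsetP/(_ _ zW) zWQ /stableP; apply.
have zN : z \in unstable e.
  rewrite inE ze; apply/negP => clz.
  have eSz : e :\: S \subset e :\ z by rewrite setDS ?sub1set.
  by have := Wz _ eSz clz; rewrite !inE eqxx.
have [y] : exists2 y, y \in S :&: unstable e & y != z.
  apply/exists_inP; apply: contraR cSN => /exists_inPn noy.
  apply/cards1P; exists z; apply/setP => y; rewrite in_set1.
  apply/idP/eqP => [/noy|->]; first by rewrite negbK => /eqP.
  by rewrite inE zS.
rewrite inE => /andP[yS yN] yz.
have ye := subsetP Se _ yS.
have Pe : e :\ y :\ z \subset e by rewrite (subset_trans (subD1set _ _)) ?subD1set.
have cP : #|e :\ y :\ z| == r - 2.
  have := cardsD1 y e; have := cardsD1 z (e :\ y).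
  by rewrite !inE ye ze (eq_sym z) yz ce; lia.
have /implyP := forallP ge (e :\ y :\ z); rewrite Pe cP => /(_ isT).
move=> /existsP[Q /and3P[PQ Qe clQ]].
have zQ : z \in Q.
  apply: Wz clQ; apply: subset_trans PQ; apply/subsetP => x.
  rewrite !inE => /andP[xS ->]; rewrite andbT.
  by apply/andP; split; apply: contraNneq xS => ->.
have zey : z \in e :\ y by rewrite !inE eq_sym yz.
have yQ : e :\ y \subset Q by rewrite -(setD1K zey) subUset sub1set zQ.
have /andP[Qse /negP nQe] : (Q \subset e) && ~~ (e \subset Q) by [].
have defQ : Q = e :\ y.
  apply/eqP; rewrite eqEsubset yQ andbT subsetD1 Qse; apply/negP => yinQ.
  by apply: nQe; rewrite -(setD1K ye) subUset sub1set yinQ.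
by move: yN; rewrite inE ye -defQ clQ.
Qed.

(* A bad edge contains an [r - 2]-set P lying in no proper stable subset, so it
   is [P :|: [set x; y]] with x among the at most c elements of [W P] and then
   y among those of [W (x |: P)]. *)
Lemma card_bad r c (H : {set {set T}}) : 2 <= r -> uniform r H ->
  (forall P, #|P| <= r -> #|W P| <= c) ->
  #|[set e in H | ~~ good r e]| <= c * c * #|T| ^ (r - 2).
Proof.
move=> r2 /forall_inP Hr Wc.
pose PS := [set P : {set T} | #|P| == r - 2].
pose F P := \bigcup_(x in W P) [set y |: (x |: P) | y in W (x |: P)].
apply: (@leq_trans #|\bigcup_(P in PS) F P|).
  apply/subset_leq_card/subsetP => e; rewrite inE => /andP[/Hr/eqP ce].
  move=> /forallPn[P]; rewrite negb_imply => /andP[/andP[Pe cP] /existsPn noS].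
  apply/bigcupP; exists P; first by rewrite inE.
  have step S : P \subset S -> S \proper e ->
      exists2 x, x \in W S & x \in e :\: S.
    move=> PS' Se; have := noS S; rewrite PS' Se /= => /subsetPn[x].
    by rewrite inE => /andP[xW xe] xS; exists x => //; rewrite inE xS.
  have Pp : P \proper e by rewrite properEcard Pe ce (eqP cP); lia.
  have [x xW] := step P (subxx _) Pp; rewrite inE => /andP[xP xe].
  have cxP : #|x |: P| = r - 1 by rewrite cardsU1 xP (eqP cP); lia.
  have xPe : x |: P \subset e by rewrite subUset sub1set xe.
  have xPp : x |: P \proper e by rewrite properEcard xPe ce cxP; lia.
  have [y yW] := step _ (subsetUr _ _) xPp; rewrite inE => /andP[yP ye].
  apply/bigcupP; exists x => //; apply/imsetP; exists y => //.
  apply/eqP; rewrite eq_sym eqEcard subUset sub1set ye xPe /=.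
  by rewrite cardsU1 yP cxP ce; lia.
apply: (@leq_trans (#|PS| * (c * c))); last first.
  by rewrite mulnC leq_mul2l /PS card_draws leq_bin_expn orbT.
apply: leq_card_bigcup => P; rewrite inE => /eqP cP.
have cP1 : #|P| <= r by rewrite cP; lia.
apply: (@leq_trans (#|W P| * c)); last by rewrite leq_mul2r Wc ?orbT.
apply: leq_card_bigcup => x _; apply: leq_trans (leq_imset_card _ _) _.
by apply: Wc; rewrite cardsU1 cP; case: (x \in P); lia.
Qed.

End Stable.

(* An upper bound for the number of vertices of the bush. *)
Definition spread (r s h : nat) := r * (1 + s + s * h).

(** One term for each of the three unions that make up [forced P] when [P] has at most [r]
    elements. *)
Definition closure_bound (r s h : nat) :=
  2 ^ r * spread r s h + 2 ^ r * (2 ^ r * spread r s h)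
    + r * (spread r s h + spread r s h).

(** * Double counting and the splitting of an edge *)

Lemma setUDid (T : finType) (A B : {set T}) :
  A \subset B -> A :|: (B :\: A) = B.
Proof. by move=> AB; rewrite setDE setUIr setUCr setIT; apply/setUidPr. Qed.

Lemma weighted_shadow (T : finType) (G D : {set {set T}})
    (w : {set T} -> {set T} -> nat) c m : 0 < c ->
  (forall e, e \in G -> c <= \sum_(S in D) w e S) ->
  (forall S, S \in D -> \sum_(e in G) w e S <= m * c) ->
  #|G| <= m * #|D|.
Proof.
move=> c0 lo hi; rewrite -(leq_pmul2r c0).
apply: (@leq_trans (\sum_(e in G) \sum_(S in D) w e S)).
  by rewrite -sum_nat_const; apply: leq_sum.
rewrite exchange_big /= mulnAC mulnC -sum_nat_const; exact: leq_sum.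
Qed.

Lemma subset_of_cardI (T : finType) (e N : {set T}) p q :
  N \subset e -> p <= #|N| -> q <= #|e| - #|N| ->
  exists A : {set T}, [/\ A \subset e, #|A| = p + q & #|A :&: N| = p].
Proof.
move=> Ne pN qN.
have draw (X : {set T}) n : n <= #|X| ->
    exists2 A : {set T}, A \subset X & #|A| = n.
  rewrite -bin_gt0 -cards_draws => /card_gt0P[A]; rewrite inE.
  by case/andP=> AX /eqP; exists A.
have [A1 A1N cA1] := draw _ _ pN.
have [|A2 A2N cA2] := draw (e :\: N) q; first by rewrite cardsD (setIidPr Ne).
have [A2e dA2N] := subsetDP A2N.
have A2I : A2 :&: N = set0 by apply/eqP; rewrite setI_eq0.
exists (A1 :|: A2); split.
- by rewrite subUset A2e (subset_trans A1N).
- rewrite cardsU -cA1 -cA2; suff -> : A1 :&: A2 = set0 by rewrite cards0 subn0.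
  apply/eqP; rewrite setI_eq0 disjoint_sym; exact: disjointWr A1N dA2N.
by rewrite setIUl A2I setU0 (setIidPl A1N).
Qed.

(** Of the [m] unstable vertices of an edge, [p] go to an [a]-set and [m - p] to its complement;
    both sets are stable when neither number is 1. In the exceptional case three vertices can only
    be split as 1 and 2. *)
Lemma split_avoiding_one a b m : 1 < a -> 1 < b -> m <= a + b -> m != 1 ->
  ~~ [&& a == 2, b == 2 & m == 3] ->
  exists p, [/\ p <= m, p <= a, m - p <= b, p != 1 & m - p != 1].
Proof.
move=> a1 b1 mab m1 ex; have [mb|bm] := leqP m b.
  by exists 0; split; lia.
have [ma|am] := leqP m a; first by exists m; split; lia.
by exists (minn a (m - 2)); split; lia.
Qed.

(** * The forcing map of a hypergraph *)

Section BushFree.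
Variables (T : finType) (H : {set {set T}}) (r s h a b : nat).
Implicit Types (e f A B P Q S X Z : {set T}).

Local Notation k := (spread r s h).

(** The edges [e] in which [e :\: A] can serve as some [B_i] of a bush: its rich link supplies the
    leaves. *)
Definition rich_off A := [set e in H | rich k (link H (e :\: A))].

Definition extensions B := [set w | (w \notin B) && (w |: B \in H)].

(* The edges f avoiding v in which some vertex can be exchanged for v: the union
   of [s] disjoint ones and v is a bush when [a = h = 1]. *)
Definition switches v :=
  [set f in H | (v \notin f) && [exists w in f, v |: (f :\ w) \in H]].

Definition switch_cover v := cov k (switches v).

(* The links of v that extend in at least [s] ways, other than by v, inside the
   switch cover: disjoint ones can then be given distinct extensions. *)
Definition trapped v := [set B : {set T} |
  [&& v \notin B, v |: B \in H, [disjoint B & switch_cover v] &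
      s <= #|(extensions B :&: switch_cover v) :\ v|]].

(** The first two unions make the links of stable sets rich, in [H] and in [rich_off A]; the third
    serves the case [a = h = 1]. Ranging over all subsets of [P] makes the map monotone. *)
Definition forced P :=
  \bigcup_(Q in powerset P) cov k (link H Q)
  :|: \bigcup_(A in powerset P) \bigcup_(Q in powerset P)
        cov k (link (rich_off A) Q)
  :|: \bigcup_(v in P) (switch_cover v :|: cov k (trapped v)).

Lemma forced_mono P Q : P \subset Q -> forced P \subset forced Q.
Proof.
move=> PQ; have /subsetP PQ' : powerset P \subset powerset Q by rewrite powersetS.
apply: setUSS; first apply: setUSS.
- apply/bigcupsP => S /PQ' SQ.
  exact: (bigcup_sup S SQ).
- apply/bigcupsP => A /PQ' AQ; apply: (bigcup_max A AQ).
  by apply/bigcupsP => S /PQ' SQ; apply: (bigcup_sup S SQ).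
by apply/bigcupsP => v /(subsetP PQ) vQ; apply: (bigcup_sup v vQ).
Qed.

Lemma card_forced P : #|P| <= r -> #|forced P| <= closure_bound r s h.
Proof.
move=> cP.
have cpow : #|powerset P| <= 2 ^ r by rewrite card_powerset leq_exp2l.
apply: leq_trans (leq_card_setU _ _) _; apply: leq_add; last first.
  apply: leq_trans (leq_mul cP (leqnn _)); apply: leq_card_bigcup => v _.
  by apply: leq_trans (leq_card_setU _ _) _; rewrite leq_add ?card_cov.
apply: leq_trans (leq_card_setU _ _) _; apply: leq_add.
  apply: leq_trans (leq_mul cpow (leqnn _)); apply: leq_card_bigcup => Q _.
  exact: card_cov.
apply: leq_trans (leq_mul cpow (leqnn _)); apply: leq_card_bigcup => A _.
apply: leq_trans (leq_mul cpow (leqnn _)); apply: leq_card_bigcup => Q _.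
exact: card_cov.
Qed.

Local Notation stable := (stable forced).

Lemma stable_disjoint e Q Z : Q \subset e -> stable e Q ->
  Z \subset forced Q -> [disjoint e :\: Q & Z].
Proof.
move=> Qe clQ /subsetP ZW; rewrite -setI_eq0; apply/eqP/setP => x.
rewrite !inE; apply/negP => /andP[/andP[xQ xe] /ZW xW].
by rewrite (stableP clQ xW xe) in xQ.
Qed.

(** The set [e :\: Q] is itself a member of the link and, by stability, avoids the transversal that
    would exist if the link were not rich. *)
Lemma stable_rich e Q : e \in H -> Q \subset e -> stable e Q ->
  rich k (link H Q).
Proof.
move=> eH Qe clQ; apply: (@rich_witness _ _ _ (e :\: Q)).
  by apply/linkP; exists e.
apply: stable_disjoint => //; rewrite /forced -setUA subsetU //.
by rewrite (bigcup_sup Q) // inE.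
Qed.

Lemma stable_rich_off e A Q : e \in H -> A \subset Q -> Q \subset e ->
  stable e Q -> rich k (link H (e :\: A)) -> rich k (link (rich_off A) Q).
Proof.
move=> eH AQ Qe clQ rA; apply: (@rich_witness _ _ _ (e :\: Q)).
  by apply/linkP; exists e; rewrite inE eH.
apply: stable_disjoint => //; rewrite /forced setUAC subsetU // orbC.
by rewrite (bigcup_max A) ?inE // (bigcup_sup Q) // inE.
Qed.

(** * Configurations excluded by the absence of a bush *)

Hypothesis Hr : uniform r H.
Hypotheses (a0 : 0 < a) (b0 : 0 < b) (rab : r = a + b) (s0 : 0 < s) (h0 : 0 < h).
Hypothesis bush_free : ~ contains H (bush a b s h).

Lemma card_edge e : e \in H -> #|e| = r.
Proof. by move=> eH; apply/eqP; exact: (forall_inP Hr). Qed.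

Lemma card_link (F : {set {set T}}) Q f : F \subset H -> f \in link F Q -> #|f| <= r.
Proof.
move=> /subsetP FH /linkP[e [/FH /card_edge <- _ ->]].
exact: subset_leq_card (subsetDl _ _).
Qed.

Lemma rich_off_sub A : rich_off A \subset H.
Proof. by apply/subsetP => e; rewrite inE => /andP[]. Qed.

(** The leaves are chosen greedily in the links of the [B i], away from the whole star; [spread]
    leaves room for all of them. *)
Lemma no_rich_star A (B : 'I_s -> {set T}) :
  #|A| = a -> (forall i, #|B i| = b) -> (forall i, [disjoint A & B i]) ->
  (forall i j, i != j -> [disjoint B i & B j]) ->
  (forall i, A :|: B i \in H) -> (forall i, rich k (link H (B i))) -> False.
Proof.
move=> cA cB dAB dBB AB rB; apply: bush_free.
pose Z := A :|: \bigcup_i B i.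
have cZ : #|Z| <= r + s * r.
  apply: leq_trans (leq_card_setU _ _) _; apply: leq_add; first by lia.
  have := @leq_card_bigcup _ _ predT B r; rewrite card_ord; apply=> i _.
  by rewrite cB; lia.
have [||C [CG CZ CC]] := @disjoint_choice _ ('I_s * 'I_h)%type k r Z
    (fun p => link H (B p.1)) _ (fun p => rB p.1).
- by move=> p f; apply: card_link.
- rewrite card_prod !card_ord (leq_trans (leq_add cZ (leqnn _))) //.
  rewrite /spread; nia.
have BZ i : B i \subset Z by rewrite subsetU // (bigcup_sup i) ?orbT.
apply: (@contains_bush _ _ _ _ _ _ A B C) => //.
- move=> p; have /linkP[e [eH Be ->]] := CG p.
  by rewrite cardsD (setIidPr Be) card_edge // cB rab addnK.
- by move=> p; rewrite disjoint_sym; apply: disjointWr (CZ p); apply: subsetUl.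
- by move=> i p; rewrite disjoint_sym; apply: disjointWr (CZ p).
move=> p; have /linkP[e [eH Be ->]] := CG p.
by rewrite setUDid.
Qed.

(** Stability of the complement puts [e] into [rich_off A]; stability of [A] then makes the link of
    [A] in [rich_off A] rich, which yields [s] disjoint branches. *)
Lemma no_stable_split e A : e \in H -> A \subset e -> #|A| = a ->
  stable e A -> stable e (e :\: A) -> False.
Proof.
move=> eH Ae cA clA clB.
have rB := stable_rich eH (subsetDl _ _) clB.
have rA := stable_rich_off eH (subxx A) Ae clA rB.
have [||B [BG BZ BB]] := @disjoint_choice _ 'I_s k r A
    (fun=> link (rich_off A) A) _ (fun=> rA).
- by move=> _ f; apply: card_link (rich_off_sub A).
- by rewrite card_ord cA /spread; nia.
apply: (@no_rich_star A B) => // i; have /linkP[f [fR Af defB]] := BG i.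
- rewrite inE in fR; case/andP: fR => fH _.
  by rewrite defB cardsD (setIidPr Af) card_edge // cA rab addKn.
- by rewrite disjoint_sym.
- rewrite inE in fR; case/andP: fR => fH _.
  by rewrite defB setUDid.
by rewrite inE in fR; case/andP: fR => _; rewrite defB.
Qed.

(** Here [A] need not be stable: the branch [B i] is [x i] together with a member of the rich link
    of [x i |: A] in [rich_off A], and the distinct [x i] keep the branches apart. *)
Lemma no_stable_fan A X : #|A| = a -> s <= #|X| ->
  (forall x, x \in X -> x \notin A /\ exists e, [/\ e \in H, x |: A \subset e,
     stable e (x |: A) & stable e (e :\: A)]) -> False.
Proof.
move=> cA sX XA.
pose x (i : 'I_s) := enum_val (widen_ord sX i).
have xX i : x i \in X by apply: enum_valP.
have x_inj : injective x by move=> i j /enum_val_inj /(congr1 val) /= /val_inj.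
have [|||D [DG DZ DD]] := @disjoint_choice _ 'I_s k r (A :|: [set x i | i in 'I_s])
    (fun i => link (rich_off A) (x i |: A)).
- by move=> i f; apply: card_link (rich_off_sub A).
- move=> i; have [_ [e [eH Ae clA clB]]] := XA _ (xX i).
  have rB := stable_rich eH (subsetDl _ _) clB.
  by apply: stable_rich_off clA rB => //; apply: subsetUr.
- rewrite card_ord; have := (leq_card_setU A [set x i | i in 'I_s]).1.
  rewrite cA card_imset // card_ord => cZ.
  (* The [s] vertices [x i] to be avoided are paid for by the last term of [spread]. *)
  have : s <= r * (s * h) by rewrite mulnCA leq_pmulr // muln_gt0 h0 rab; lia.
  by rewrite /spread; nia.
have xZ i : x i \in A :|: [set x i | i in 'I_s].
  by rewrite inE imset_f ?orbT.
have xD i j : (x i \in D j) = false by apply: (disjointFl (DZ j)).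
pose B i := x i |: D i.
have /fin_all_exists[f fP] : forall i, exists f : {set T},
    [/\ f \in rich_off A, A \subset f & B i = f :\: A].
  move=> i; have /linkP[f [fR Af defD]] := DG i.
  exists f; split=> //; first by apply: subset_trans Af; apply: subsetUr.
  have xA := (XA _ (xX i)).1; rewrite /B defD; apply/setP => y.
  rewrite !inE; case: eqVneq => [->|] //=; rewrite xA.
  by rewrite (subsetP Af) // !inE eqxx.
apply: (@no_rich_star A B) => // i; have [fR Af defB] := fP i.
- rewrite inE in fR; case/andP: fR => fH _.
  by rewrite defB cardsD (setIidPr Af) card_edge // cA rab addKn.
- by rewrite defB -setI_eq0 setIDA setIC -setIDA setDv setI0.
- move=> j ij; rewrite -setI_eq0 -subset0; apply/subsetP => y; rewrite !inE.
  case: (eqVneq y (x i)) => [->|_] /=; rewrite ?xD ?orbF.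
    by move=> /eqP/x_inj eij; rewrite eij eqxx in ij.
  case: (eqVneq y (x j)) => [->|_] /=; rewrite ?xD //.
  by move=> /andP[yi]; rewrite (disjointFr (DD _ _ ij)).
- rewrite inE in fR; case/andP: fR => fH _.
  by rewrite defB setUDid.
by rewrite inE in fR; case/andP: fR => _; rewrite defB.
Qed.

(** * Good edges and the shadow *)

Definition goods := [set e in H | good forced r e].

Local Notation unstable := (unstable forced).

Hypotheses (r3 : 2 < r).

Lemma goodsH e : e \in goods -> e \in H.
Proof. by rewrite inE => /andP[]. Qed.

Lemma stable_compl e S : e \in goods -> S \subset e ->
  #|S :&: unstable e| != 1 -> stable e (e :\: S).
Proof.
rewrite inE => /andP[eH ge] Se cS.
exact: (good_stable forced_mono (card_edge eH) ge Se cS).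
Qed.

Lemma shadow_setD1 e x : e \in goods -> x \in e -> e :\ x \in shadow r H.
Proof.
move=> /goodsH eH xe; rewrite inE; apply/andP; split.
  by have := cardsD1 x e; rewrite xe (card_edge eH); lia.
by apply/exists_inP; exists e => //; apply: subD1set.
Qed.

Lemma card_shadow S : S \in shadow r H -> #|S| = r.-1.
Proof. by rewrite inE => /andP[/eqP]. Qed.

Lemma edge_over_shadow e S : S \in shadow r H -> e \in H -> S \subset e ->
  exists2 x, x \notin S & e = x |: S.
Proof.
move=> /card_shadow cS eH Se.
have /cards1P[x eSx] : #|e :\: S| == 1.
  by rewrite cardsD (setIidPr Se) card_edge // cS; lia.
exists x; first by have := set11 x; rewrite -eSx inE => /andP[].
by rewrite -(setUDid Se) eSx setUC.
Qed.

Lemma leq_card_over S (Y : {set {set T}}) : S \in shadow r H ->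
  Y \subset H -> {in Y, forall e, S \subset e} ->
  #|Y| <= #|[set x | (x \notin S) && (x |: S \in Y)]|.
Proof.
move=> Ssh /subsetP YH YS; set X := [set x | _].
apply: leq_trans (leq_imset_card (fun x => x |: S) X).
apply/subset_leq_card/subsetP => e eY.
have [x xS defe] := edge_over_shadow Ssh (YH _ eY) (YS _ eY).
by apply/imsetP; exists x; rewrite // inE xS -defe.
Qed.

(** * The count for [a >= 2] *)

Section LargeRoot.
Hypothesis a2 : 1 < a.

(** If [e = x |: S] and [A = S :\: D], an [a]-set, the two stable sets are [x |: D] and [x |: A], as
    [no_stable_fan] requires. *)
Let admissible e S (D : {set T}) := [&& S \subset e, D \subset S, #|D| == b.-1,
  stable e (e :\: (S :\: D)) & stable e (e :\: D)].

Let w e S := #|[set D | admissible e S D]|.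

(** Fixing [D] fixes the root [S :\: D], and the edges for which [D] is admissible form a fan over
    it, so there are at most [s - 1] of them. *)
Lemma admissible_upper S : S \in shadow r H ->
  \sum_(e in goods) w e S <= s.-1 * 'C(r.-1, b.-1).
Proof.
move=> Ssh; rewrite /w.
under eq_bigr do rewrite -sum1dep_card.
rewrite (exchange_big_dep (fun D : {set T} => (D \subset S) && (#|D| == b.-1)))
  /=; last by move=> e D _ /and5P[_ -> ->].
rewrite -(card_shadow Ssh) -cards_draws mulnC -sum_nat_const.
rewrite [leqRHS](eq_bigl (fun D : {set T} => (D \subset S) && (#|D| == b.-1)));
  last by move=> D; rewrite inE.
apply: leq_sum => D /andP[DS /eqP cD].
rewrite sum1dep_card; set Y := [set e | _].
have YP e : e \in Y -> [/\ e \in H, S \subset e,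
    stable e (e :\: (S :\: D)) & stable e (e :\: D)].
  by rewrite inE => /andP[/goodsH -> /and5P[]].
have YH : Y \subset H by apply/subsetP => e /YP[].
have YS : {in Y, forall e, S \subset e} by move=> e /YP[].
rewrite -ltnS prednK // ltnNge; apply/negP => sY.
have sX := leq_trans sY (leq_card_over Ssh YH YS).
apply: (no_stable_fan _ sX (A := S :\: D)).
  by rewrite cardsD (setIidPr DS) (card_shadow Ssh) cD; lia.
move=> x; rewrite inE => /andP[xS /YP[eH _ stA stD]].
split; first by rewrite inE negb_and xS orbT.
exists (x |: S).
have eD : (x |: S) :\: D = x |: (S :\: D).
  apply/setP => y; rewrite !inE; case: eqVneq => [->|] //=.
  by rewrite andbT; apply: contra xS; apply: (subsetP DS).
by rewrite -eD; split => //; apply: subsetDl.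
Qed.

Lemma admissible_lower e : e \in goods ->
  'C(r.-1, b.-1) <= \sum_(S in shadow r H) w e S.
Proof.
move=> eG; have eH := goodsH eG; have ce := card_edge eH.
have NI S : S \subset e -> [disjoint S & unstable e] -> stable e (e :\: S).
  by move=> Se; rewrite -setI_eq0 => /eqP d; apply: stable_compl; rewrite // d cards0.
have one S : S \in shadow r H -> w e S <= \sum_(S in shadow r H) w e S.
  by move=> Ssh; rewrite (bigD1 S) //= leq_addr.
have cD1 x : x \in e -> #|e :\ x| = r.-1.
  by move=> xe; rewrite (card_shadow (shadow_setD1 eG xe)).
(* Every subset of [e :\ x] avoids the only unstable vertex [x], so all [D] of size [b - 1] are
   admissible for [S = e :\ x]. *)
have [/cards1P[x eN]|N1] := boolP (#|unstable e| == 1).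
  have xe : x \in e by apply: (subsetP (unstable_sub forced e)); rewrite eN set11.
  apply: leq_trans (one _ (shadow_setD1 eG xe)).
  rewrite -(cD1 x xe) -cards_draws; apply/subset_leq_card/subsetP => D.
  rewrite !inE => /andP[De cD]; rewrite /admissible De cD subD1set /=.
  have dx (Q : {set T}) : Q \subset e :\ x -> [disjoint Q & unstable e].
    by move=> /subsetD1P[_ xQ]; rewrite eN disjoint_sym disjoints1.
  apply/andP; split; apply: NI; try exact: dx.
  - exact: subset_trans (subsetDl _ _) (subD1set _ _).
  - by apply: dx; apply: subsetDl.
  exact: subset_trans De (subD1set _ _).
(* Here weight 1 suffices, from [D = set0] and some [S = e :\ x] not containing exactly one unstable
   vertex. Any [x] will do, unless there are two unstable vertices; then [x] is taken outside
   them. *)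
have [b1|b1] := eqVneq b 1.
  have [x xe cx] : exists2 x, x \in e & #|(e :\ x) :&: unstable e| != 1.
    have [N2|N2] := eqVneq #|unstable e| 2.
      have [x xe xN] : exists2 x, x \in e & x \notin unstable e.
        apply/subsetPn; apply: contraL (r3) => /subset_leq_card.
        by rewrite ce N2; lia.
      exists x => //; rewrite setIDAC (setIidPr (unstable_sub _ _)).
      by have := cardsD1 x (unstable e); rewrite (negPf xN) N2; lia.
    have /card_gt0P[x xe] : 0 < #|e| by rewrite ce; lia.
    exists x => //; rewrite setIDAC (setIidPr (unstable_sub _ _)).
    by have := cardsD1 x (unstable e); case: (x \in _); lia.
  apply: leq_trans (one _ (shadow_setD1 eG xe)).
  rewrite b1 bin0 card_gt0; apply/set0Pn; exists set0.
  rewrite inE /admissible subD1set sub0set cards0 b1 eqxx !setD0 stableT.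
  by rewrite andbT; apply: stable_compl; rewrite ?subD1set.
have cN : #|unstable e| <= a + b.
  by rewrite -rab -ce subset_leq_card ?unstable_sub.
(* Outside the exceptional case some [a]-set and its complement are both stable, which is
   impossible. *)
have [/and3P[/eqP ea /eqP eb /eqP N3]|ex] :=
    boolP [&& a == 2, b == 2 & #|unstable e| == 3]; last first.
  have b2 : 1 < b by lia.
  have [p [pN pa pb p1 q1]] := split_avoiding_one a2 b2 cN N1 ex.
  have [|A [Ae cA cAN]] := subset_of_cardI (q := a - p) (unstable_sub forced e) pN.
    by rewrite ce; lia.
  have AC : (e :\: A) :&: unstable e = unstable e :\: A.
    by rewrite setIDAC (setIidPr (unstable_sub _ _)).
  case: (no_stable_split eH Ae).
  - by rewrite cA; lia.
  - have eA : e :\: (e :\: A) = A by rewrite setDDr setDv set0U (setIidPr Ae).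
    rewrite -[A]eA; apply: stable_compl; rewrite ?subsetDl // AC cardsD setIC cAN //.
  by apply: stable_compl; rewrite // cAN.
(* Three of the four vertices are unstable. Each of the three sets [e :\ x] with [x] unstable
   contributes through [D], the fourth vertex, which matches ['C(3, 1) = 3]. *)
have r4 : r = 4 by rewrite rab ea eb.
pose D := e :\: unstable e.
have cD : #|D| = 1 by rewrite cardsD (setIidPr (unstable_sub _ _)) ce N3 r4.
pose SN := [set e :\ x | x in unstable e].
have cSN : #|SN| = 'C(r.-1, b.-1).
  rewrite card_in_imset ?N3 ?r4 ?eb // => x y xN yN exy; apply/eqP.
  have xe := subsetP (unstable_sub _ _) _ xN.
  by apply: contraT => xy; have := setD11 x e; rewrite exy !inE xy xe.
apply: (@leq_trans (\sum_(S in SN) w e S)).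
  rewrite -cSN -sum1_card; apply: leq_sum => _ /imsetP[x xN ->].
  have xe := subsetP (unstable_sub _ _) _ xN.
  rewrite card_gt0; apply/set0Pn; exists D.
  rewrite inE /admissible subD1set cD eb eqxx /=; apply/and3P; split.
  - by rewrite subsetD1 subsetDl inE xN.
  - apply: stable_compl => //.
      exact: subset_trans (subsetDl _ _) (subD1set _ _).
    have -> : ((e :\ x) :\: D) :&: unstable e = unstable e :\ x.
      apply/setP => y; rewrite /D !in_setI !in_setD in_set1.
      have := subsetP (unstable_sub forced e) y.
      by case: (y == x) (y \in e) (y \in unstable e) => [] [] [] // /(_ isT).
    by have := cardsD1 x (unstable e); rewrite xN N3; lia.
  apply: NI; first exact: subsetDl.
  by rewrite -setI_eq0 /D setIDAC setIC setDIl setDv set0I.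
rewrite [leqRHS](bigID (mem SN)) /=.
rewrite (eq_bigl (fun S => (S \in shadow r H) &&
    (S \in SN))) ?leq_addr // => S.
apply/idP/andP => [SSN|[]//]; split=> //.
have /imsetP[x xN ->] := SSN; apply: shadow_setD1 => //.
exact: (subsetP (unstable_sub _ _)) xN.
Qed.

Lemma goods_le_large_root : #|goods| <= s.-1 * #|shadow r H|.
Proof.
apply: (weighted_shadow (w := w) _ admissible_lower admissible_upper).
by rewrite bin_gt0; lia.
Qed.

End LargeRoot.

(** * The count for [a = h = 1] *)

Section SingletonRoot.
Hypotheses (a1 : a = 1) (h1 : h = 1).

Lemma no_matched_star v (B : 'I_s -> {set T}) (w : 'I_s -> T) :
  (forall i, v \notin B i) -> (forall i, w i != v) ->
  (forall i j, w i \notin B j) -> injective w ->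
  (forall i j, i != j -> [disjoint B i & B j]) ->
  (forall i, v |: B i \in H) -> (forall i, w i |: B i \in H) -> False.
Proof.
move=> vB wv wB w_inj dBB vBH wBH; apply: bush_free.
apply: (@contains_bush _ _ _ _ _ _ [set v] B (fun p => [set w p.1])) => //.
- by rewrite cards1.
- by move=> i; have := card_edge (vBH i); rewrite cardsU1 vB rab a1 => -[].
- by move=> p; rewrite cards1.
- by move=> i; rewrite disjoints1.
- by move=> p; rewrite disjoints1 in_set1 eq_sym.
- by move=> i p; rewrite disjoint_sym disjoints1.
- move=> [i j] [i' j'] /= ij; rewrite disjoints1 in_set1.
  apply: contraNneq ij => /w_inj ->; apply/eqP; congr pair; apply: ord_inj.
  by case: j j' => [j jh] [j' jh'] /=; lia.
by move=> [i j] /=; rewrite setUC.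
Qed.

Lemma switches_not_rich v : ~~ rich k (switches v).
Proof.
apply/negP => rE.
have [||f [fE fv ff]] := @disjoint_choice _ 'I_s k r [set v]
    (fun=> switches v) _ (fun=> rE).
- by move=> _ f; rewrite inE => /andP[/card_edge ->].
- by rewrite card_ord cards1 /spread; nia.
have /fin_all_exists[w wP] : forall i, exists w, w \in f i /\
    v |: (f i :\ w) \in H.
  by move=> i; have := fE i; rewrite inE => /and3P[_ _ /exists_inP[w]]; exists w.
have fH i : f i \in H by have := fE i; rewrite inE => /andP[].
have vf i : v \notin f i by have := fE i; rewrite inE => /and3P[].
have wf i j : w i \in f j -> i = j.
  move=> wj; apply: contraTeq wj => /ff dij.
  by rewrite (disjointFr dij) // (wP i).1.
apply: (@no_matched_star v (fun i => f i :\ w i) w).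
- by move=> i; rewrite !inE (negPf (vf i)) andbF.
- by move=> i; apply: contraNneq (vf i) => <-; case: (wP i).
- by move=> i j; rewrite !inE; apply/andP => -[+ /wf eij]; rewrite eij eqxx.
- by move=> i j eij; apply: wf; rewrite eij; case: (wP j).
- move=> i j ij; apply: disjointW (ff _ _ ij); exact: subD1set.
- by move=> i; case: (wP i).
by move=> i; rewrite setD1K //; case: (wP i).
Qed.

Lemma trapped_not_rich v : ~~ rich k (trapped v).
Proof.
apply/negP => rR.
have tB B : B \in trapped v -> v \notin B /\ v |: B \in H.
  by rewrite inE => /and4P[].
have [||B [BR Bv BB]] := @disjoint_choice _ 'I_s k r [set v]
    (fun=> trapped v) _ (fun=> rR).
- move=> _ B /tB[vB /card_edge]; rewrite cardsU1 vB; lia.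
- by rewrite card_ord cards1 /spread; nia.
pose M i := (extensions (B i) :&: switch_cover v) :\ v.
have cM i : s <= #|M i| by have := BR i; rewrite inE => /and4P[].
(* Distinct representatives of [s] sets of size at least [s], obtained as disjoint singletons. *)
have [|||g [gM _ gg]] := @disjoint_choice _ 'I_s s.-1 1 set0
    (fun i => [set [set w] | w in M i]).
- by move=> i _ /imsetP[w _ ->]; rewrite cards1.
- move=> i; apply/richP => Z cZ.
  have /subsetPn[w wM wZ] : ~~ (M i \subset Z).
    by apply/negP => /subset_leq_card; have := cM i; lia.
  by exists [set w]; rewrite ?imset_f // disjoints1.
- by rewrite card_ord cards0; lia.
have /fin_all_exists[w wP] : forall i, exists w, w \in M i /\ g i = [set w].
  by move=> i; have /imsetP[w] := gM i; exists w.
have wM i : [/\ w i != v, w i \in extensions (B i) & w i \in switch_cover v].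
  by have := (wP i).1; rewrite !inE => /and3P[-> /andP[-> ->] ->].
apply: (@no_matched_star v B w) => //.
- by move=> i; have [] := tB _ (BR i).
- by move=> i; have [] := wM i.
- move=> i j; have [_ _ wU] := wM i.
  have := BR j; rewrite inE => /and4P[_ _ dBU _].
  by rewrite (disjointFl dBU).
- move=> i j eij; apply: contraTeq isT => /gg.
  by rewrite (wP i).2 (wP j).2 eij disjoints1 inE eqxx.
- by move=> i; have [] := tB _ (BR i).
by move=> i; have [_ + _] := wM i; rewrite inE => /andP[].
Qed.

(** By stability [e :\ v] avoids both covers. For any other extension [w], [w |: (e :\ v)] is a
    switch of [v] and meets the switch cover, necessarily in [w]. More than [s] extensions would
    make [e :\ v] trapped, yet it avoids the cover of the trapped sets. *)
Lemma card_extensions_le e v : e \in H -> v \in e -> stable e [set v] ->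
  #|extensions (e :\ v)| <= s.
Proof.
move=> eH ve st; set B := e :\ v.
have vB : v \notin B by rewrite !inE eqxx.
have vBe : v |: B = e by rewrite setD1K.
have sub Z : Z \subset switch_cover v :|: cov k (trapped v) -> [disjoint B & Z].
  move=> ZU; apply: (stable_disjoint _ st); first by rewrite sub1set.
  by rewrite subsetU // (bigcup_max v) ?in_set1 ?orbT.
have dBU : [disjoint B & switch_cover v] by apply: sub; apply: subsetUl.
have dBR : [disjoint B & cov k (trapped v)] by apply: sub; apply: subsetUr.
clearbody B; have extU : extensions B :\ v \subset (extensions B :&: switch_cover v) :\ v.
  apply/subsetP => w; rewrite !inE => /and3P[wv wB wBH].
  rewrite wv wB wBH /=; apply: contraT => wU.
  have : w |: B \in switches v.
    rewrite inE wBH in_setU1 negb_or (eq_sym v) wv vB /=.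
    apply/exists_inP; exists w; rewrite ?setU11 //.
    by rewrite setU1K ?vBe.
  move/(covP (switches_not_rich v)); rewrite -setI_eq0 setIUl setU_eq0.
  by rewrite !setI_eq0 disjoints1 wU dBU.
rewrite leqNgt; apply/negP => cB.
have : B \in trapped v.
  rewrite inE vB vBe eH dBU /=; apply: leq_trans (subset_leq_card extU).
  by have := cardsD1 v (extensions B); case: (v \in _); lia.
by move/(covP (trapped_not_rich v)); rewrite dBR.
Qed.

Hypothesis s2 : 1 < s.

Definition pivots S := [set x |
  [&& x \notin S, x |: S \in goods & unstable (x |: S) == [set x]]].

Lemma pivotsP S x : reflect
  [/\ x \notin S, x |: S \in goods & unstable (x |: S) = [set x]]
  (x \in pivots S).
Proof.
rewrite [x \in pivots S]in_set.
by apply: (iffP and3P) => -[xS xG /eqP xN]; split => //; apply/eqP.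
Qed.

(** The pivots of both sets form a fan over the common vertex [u]: in an edge with pivot [x],
    removing any set that avoids [x] leaves a stable set. *)
Lemma card_pivotsU S S' u : u \in S -> u \in S' ->
  #|pivots S :|: pivots S'| < s.
Proof.
move=> uS uS'; rewrite ltnNge; apply/negP => sX.
apply: (no_stable_fan _ sX (A := [set u])); first by rewrite cards1.
have main Q x : u \in Q -> x \in pivots Q -> x \notin [set u] /\
    exists e, [/\ e \in H, x |: [set u] \subset e, stable e (x |: [set u]) &
      stable e (e :\: [set u])].
  move=> uQ /pivotsP[xQ eG eN].
  have ux : (x == u) = false by apply: contraNF xQ => /eqP ->.
  have dN Z : x \notin Z -> Z \subset x |: Q -> stable (x |: Q) ((x |: Q) :\: Z).
    move=> xZ Ze; apply: stable_compl => //.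
    by rewrite eN setIC; have /eqP -> : [set x] :&: Z == set0;
      rewrite ?cards0 // setI_eq0 disjoints1.
  split; first by rewrite inE ux.
  exists (x |: Q); split; first exact: goodsH.
  - by rewrite setUS // sub1set.
  - have <- : (x |: Q) :\: (Q :\ u) = x |: [set u].
      apply/setP => y; rewrite !inE; have [->|yx] := eqVneq y x.
        by rewrite (negPf xQ) andbF.
      by have [->|yu] := eqVneq y u; rewrite ?uQ //=; case: (y \in Q).
    apply: dN; first by rewrite !inE (negPf xQ) andbF.
    exact: subset_trans (subD1set _ _) (subsetUr _ _).
  by apply: dN; rewrite ?inE ?ux // sub1set !inE uQ orbT.
by move=> x /setUP[] /main; apply.
Qed.

(* A vertex x attached to [e :\ v] makes e a switch of x, and the switch cover
   of x can meet e only in v because [[set x]] is stable in [x |: e :\ v]. *)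
Lemma pivot_root e v w x : v \in e -> x \notin e -> x \in pivots (e :\ v) ->
  w \in e -> w \in switch_cover x -> w = v.
Proof.
move=> ve xe /pivotsP[xS gG gN] we wU.
apply/eqP; apply: contraT => wv.
have st : stable (x |: (e :\ v)) [set x].
  have gx : (x |: (e :\ v)) :\: (e :\ v) = [set x].
    apply/setP => y; rewrite in_setD in_setU1 in_set1.
    by have [->|] := eqVneq y x; rewrite ?xS //= andNb.
  rewrite -[X in stable _ X]gx; apply: stable_compl; rewrite ?subsetUr //.
  by rewrite gN setIC; have /eqP -> : [set x] :&: (e :\ v) == set0;
    rewrite ?cards0 // setI_eq0 disjoints1.
have : w \in [set x].
  apply: stableP st _ _; last by rewrite !inE wv we orbT.
  by rewrite inE (_ : w \in \bigcup_(_ in _) _) ?orbT //;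
    apply/bigcupP; exists x; rewrite ?set11 // inE wU.
by rewrite inE => /eqP wx; rewrite -wx we in xe.
Qed.

(** For distinct [v] and [v'], a common vertex of [e :\ v] and [e :\ v'] bounds the union of their
    pivot sets by [s - 1], so the two coincide. A common pivot [x] lies outside [e], and the vertex
    where [e] meets the switch cover of [x] would be both [v] and [v']. *)
Lemma full_pivots_uniq e v v' : e \in goods -> v \in e -> v' \in e ->
  s.-1 <= #|pivots (e :\ v)| -> s.-1 <= #|pivots (e :\ v')| -> v = v'.
Proof.
move=> eG ve v'e cP cP'; apply/eqP; apply: contraT => vv'.
have eH := goodsH eG.
have [u] : exists u, u \in e :\ v :\ v'.
  apply/set0Pn; rewrite -card_gt0.
  have := cardsD1 v' (e :\ v); have := cardsD1 v e.
  by rewrite !inE ve v'e (eq_sym v') vv' (card_edge eH); lia.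
rewrite !inE => /and3P[uv' uv ue].
have uS : u \in e :\ v by rewrite !inE uv.
have uS' : u \in e :\ v' by rewrite !inE uv'.
have cU : #|pivots (e :\ v) :|: pivots (e :\ v')| <= s.-1.
  by rewrite -ltnS prednK // (card_pivotsU uS uS').
have eU : pivots (e :\ v) = pivots (e :\ v) :|: pivots (e :\ v').
  by apply/eqP; rewrite eqEcard subsetUl (leq_trans cU).
have eU' : pivots (e :\ v') = pivots (e :\ v) :|: pivots (e :\ v').
  by apply/eqP; rewrite eqEcard subsetUr (leq_trans cU).
have /card_gt0P[x xP] : 0 < #|pivots (e :\ v)|.
  by apply: leq_trans cP; rewrite -subn1 subn_gt0.
have xP' : x \in pivots (e :\ v') by rewrite eU' -eU.
have xe : x \notin e.
  have [[xS _ _] [xS' _ _]] := (pivotsP _ _ xP, pivotsP _ _ xP').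
  apply: contra vv' => xe; move: xS xS'; rewrite !inE xe !andbT !negbK.
  by move=> /eqP <- /eqP <-.
have eSw : e \in switches x.
  rewrite inE eH xe; apply/exists_inP; exists v => //.
  by have /pivotsP[_ /goodsH] := xP.
have := covP (switches_not_rich x) eSw.
rewrite -setI_eq0 => /set0Pn[w]; rewrite inE => /andP[we wU].
by rewrite -(pivot_root ve xe xP we wU) (pivot_root v'e xe xP' we wU) eqxx in vv'.
Qed.

(** Otherwise, for [v] in [e] not unstable, both [[set v]] and [e :\ v] have stable complements,
    against [no_stable_split]. *)
Lemma unstable_dichotomy e : e \in goods ->
  #|unstable e| = 1 \/ unstable e = e.
Proof.
move=> eG; have [N1|N1] := eqVneq #|unstable e| 1; [by left | right].
apply/eqP; rewrite eqEsubset unstable_sub; apply: contraT => /subsetPn[v ve vN].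
have dv : [set v] :&: unstable e = set0.
  by apply/eqP; rewrite setI_eq0 disjoints1.
case: (no_stable_split (goodsH eG) (A := [set v])).
- by rewrite sub1set.
- by rewrite cards1.
- have <- : e :\: (e :\ v) = [set v].
    by rewrite setDDr setDv set0U; apply/setIidPr; rewrite sub1set.
  apply: stable_compl; rewrite ?subD1set // setIDAC (setIidPr (unstable_sub _ _)).
  by have := cardsD1 v (unstable e); rewrite (negPf vN) add0n => <-.
by apply: stable_compl; rewrite ?sub1set // dv cards0.
Qed.

Let pointed e S := (S \subset e) && (unstable e == e :\: S).

Let unpointed e S := (S \subset e) && (unstable e == e).

(* An edge with one unstable vertex x puts its whole weight on [e :\ x]; an
   edge without stable [r - 1]-subsets spreads it over the subsets that do not
   already carry [s - 1] edges of the first kind, of which it has at least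
   [r - 1 >= 2]. *)
Let w e S := 2 * pointed e S + unpointed e S * (#|pivots S| < s.-1).

Lemma pivot_lower e : e \in goods -> 2 <= \sum_(S in shadow r H) w e S.
Proof.
move=> eG; have eH := goodsH eG.
have [N1|Ne] := unstable_dichotomy eG.
  have /cards1P[x eN] : #|unstable e| == 1 by apply/eqP.
  have xe : x \in e by apply: (subsetP (unstable_sub forced e)); rewrite eN set11.
  rewrite (bigD1 (e :\ x)) ?shadow_setD1 //= {1}/w /pointed subD1set eN.
  rewrite setDDr setDv set0U (setIidPr _) ?sub1set // eqxx; lia.
pose V := [set v in e | #|pivots (e :\ v)| < s.-1].
have cV : 1 < #|V|.
  (* By [full_pivots_uniq], only one vertex of [e] can fail to be in [V]. *)
  have cVC : #|e :\: V| <= 1.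
    apply/card_le1P => v; rewrite !inE => /andP[vV ve] v'.
    rewrite !inE; apply/andP/eqP => [[v'V v'e]|->]; last by rewrite ve in vV *.
    rewrite ve /= -leqNgt in vV; rewrite v'e /= -leqNgt in v'V.
    exact: full_pivots_uniq vV.
  have := cardsID V e; rewrite (card_edge eH).
  by have := subset_leq_card (subsetIr e V); lia.
apply: leq_trans cV _.
have inj : {in V &, injective (fun v => e :\ v)}.
  move=> x y; rewrite !inE => /andP[xe _] _ exy; apply/eqP; apply: contraT => xy.
  by have := setD11 x e; rewrite exy !inE xy xe.
rewrite -(card_in_imset inj) -sum1_card.
rewrite [leqRHS](bigID (mem [set e :\ v | v in V])) /=.
apply: leq_trans (leq_addr _ _).
rewrite [leqRHS](eq_bigl (fun S => S \in [set e :\ v | v in V])); last first.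
  move=> S; apply/andP/idP => [[]//|SV]; split=> //.
  have /imsetP[v] := SV; rewrite inE => /andP[ve _ ->].
  exact: shadow_setD1.
apply: leq_sum => _ /imsetP[v + ->]; rewrite inE => /andP[ve cP].
by rewrite /w /unpointed subD1set Ne eqxx cP; lia.
Qed.

(** With [s - 1] pivots the second weight vanishes. With fewer, [#|Y1| <= s - 2], and a nonempty
    [Y2] gives [#|Y1| + #|Y2| <= s] by [card_extensions_le]; the sum of the two bounds is
    [2 * (s - 1)]. *)
Lemma pivot_upper S : S \in shadow r H -> \sum_(e in goods) w e S <= s.-1 * 2.
Proof.
move=> Ssh; rewrite /w big_split /= -big_distrr -big_distrl /=.
pose Y1 := [set e in goods | pointed e S].
pose Y2 := [set e in goods | unpointed e S].
have sumE (p : pred {set T}) :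
    \sum_(e in goods) p e = #|[set e in goods | p e]|.
  rewrite -sum1_card big_mkcond [RHS]big_mkcond; apply: eq_bigr => e _.
  by rewrite inE; case: (e \in goods); case: (p e).
rewrite (sumE (pointed^~ S)) (sumE (unpointed^~ S)) -/Y1 -/Y2.
have Y1H : Y1 \subset H by apply/subsetP => e; rewrite inE => /andP[/goodsH].
have Y2H : Y2 \subset H by apply/subsetP => e; rewrite inE => /andP[/goodsH].
have Y1S : {in Y1, forall e, S \subset e}.
  by move=> e; rewrite inE => /and3P[].
have Y2S : {in Y2, forall e, S \subset e}.
  by move=> e; rewrite inE => /and3P[].
have cS := card_shadow Ssh.
have /card_gt0P[u uS] : 0 < #|S| by rewrite cS; lia.
have Y1p : #|Y1| <= #|pivots S|.
  apply: leq_trans (leq_card_over Ssh Y1H Y1S) _; apply/subset_leq_card.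
  apply/subsetP => x; rewrite !inE => /andP[xS /and3P[-> _ /eqP ->]].
  rewrite xS /=; apply/eqP/setP => y; rewrite in_setD in_setU1 in_set1.
  by have [->|] := eqVneq y x; rewrite ?xS //= andNb.
have p_lt : #|pivots S| < s by have := card_pivotsU uS uS; rewrite setUid.
case: ltnP => p_s; last by lia.
have [->|/set0Pn[e eY2]] := eqVneq Y2 set0; first by rewrite cards0; lia.
have dY : [disjoint Y1 & Y2].
  rewrite -setI_eq0; apply/eqP/setP => f; rewrite !inE; apply/negP.
  move=> /andP[/and3P[_ Sf /eqP N1] /and3P[_ _ /eqP]]; rewrite N1.
  by move=> /setP/(_ u); rewrite inE uS (subsetP Sf).
have cY : #|Y1 :|: Y2| <= #|extensions S|.
  have YH : Y1 :|: Y2 \subset H by rewrite subUset Y1H.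
  have YS : {in Y1 :|: Y2, forall f, S \subset f}.
    by move=> f /setUP[/Y1S|/Y2S].
  apply: leq_trans (leq_card_over Ssh YH YS) _; apply/subset_leq_card.
  apply/subsetP => x; rewrite !inE => /andP[-> xY] /=.
  by apply: (subsetP YH); rewrite !inE.
have cE : #|extensions S| <= s.
  have [x xS defe] := edge_over_shadow Ssh (subsetP Y2H _ eY2) (Y2S _ eY2).
  have eS : S = e :\ x by rewrite defe setU1K.
  rewrite eS; apply: card_extensions_le; rewrite ?(subsetP Y2H) //.
    by rewrite defe setU11.
  have <- : e :\: S = [set x].
    apply/setP => y; rewrite defe in_setD in_setU1 in_set1.
    by have [->|] := eqVneq y x; rewrite ?xS //= andNb.
  move: eY2; rewrite inE => /and3P[eG Se /eqP eN].
  by apply: stable_compl => //; rewrite eN (setIidPl Se) cS; lia.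
rewrite cardsU (_ : Y1 :&: Y2 = set0) ?cards0 in cY; last first.
  by apply/eqP; rewrite setI_eq0.
lia.
Qed.

Lemma goods_le_singleton_root : #|goods| <= s.-1 * #|shadow r H|.
Proof. exact: (weighted_shadow (w := w) _ pivot_lower pivot_upper). Qed.

End SingletonRoot.

End BushFree.

(** * Good and bad edges combined *)

Import Order.TTheory GRing.Theory Num.Theory.
Local Open Scope ring_scope.

Theorem theorem3 (R : realType) (r s h : nat)
    (hr : (3 <= r)%N) (hs : (2 <= s)%N) (hh : (0 < h)%N) :
  exists C : R, 0 < C /\
    forall a b : nat, (0 < a)%N -> (0 < b)%N -> r = (a + b)%N ->
      ((a, b) = (1%N, (r - 1)%N) -> h = 1%N) ->
      forall (n : nat) (T : finType) (H : {set {set T}}),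
        #|T| = n -> uniform r H ->
        (s - 1)%N%:R * #|shadow r H|%:R + C * n%:R ^+ (r - 2) < #|H|%:R ->
        contains H (bush a b s h).
Proof.
pose c := closure_bound r s h.
(* The factor [c * c] comes from [card_bad]; the successor makes positivity immediate. *)
exists (c * c).+1%:R; split; first by rewrite ltr0n.
move=> a b a0 b0 rab h1 n T H <- Hr; apply: contraPP => bush_free.
apply/negP; rewrite -leNgt -natrX -!natrM -natrD ler_nat.
rewrite -(cardsID (goods H r s h) H) leq_add //.
  apply: leq_trans (subset_leq_card (subsetIr _ _)) _; rewrite subn1.
  have [a1|a1] := eqVneq a 1%N.
    have h_1 : h = 1%N by apply: h1; rewrite a1; congr pair; lia.
    by apply: (goods_le_singleton_root (a := a) (b := b)) => //; lia.
  by apply: (goods_le_large_root (a := a) (b := b)) => //; lia.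
have -> : H :\: goods H r s h = [set e in H | ~~ good (forced H r s h) r e].
  apply/setP => e; rewrite in_setD 2!in_set.
  by case: (e \in H); rewrite /= ?andbT ?andbF.
apply: leq_trans (card_bad _ _ (@card_forced _ H r s h)) _ => //; first by lia.
by rewrite leq_mul2r leqnSn orbT.
Qed.
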